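(* Let $\mathcal{A}=(U,\mathcal{C})$ be a convex geometry of convex dimension $d=\mathrm{cdim}(\mathcal{C})$. Then $\mathcal{A}$ is realizable in $\mathbb{R}^d$.
   Context: A convex geometry is a pair $(U,\mathcal{C})$ with $U$ a finite set and $\mathcal{C}\subseteq 2^U$ such that (C1) $\varnothing,U\in\mathcal{C}$; (C2) $X\cap Y\in\mathcal{C}$ for all $X,Y\in\mathcal{C}$; (C3) for every $X\in\mathcal{C}\setminus\{U\}$ there is $e\in U\setminus X$ with $X\cup\{e\}\in\mathcal{C}$. A set $\{\leq_1,\dots,\leq_d\}$ of total orders on $U$ generates $\mathcal{C}\subseteq 2^U$ if $\varnothing\in\mathcal{C}$ and a nonempty set $C\subseteq U$ belongs to $\mathcal{C}$ if and only if there are $e_1,\dots,e_d\in U$ with $C=\{e\in U: e_i\leq_i e\text{ for all }1\leq i\leq d\}$. Every convex geometry is generated by some set of total orders; the convex dimension $\mathrm{cdim}(\mathcal{C})$ is the least number of total orders generating $\mathcal{C}$. A family $\mathcal{C}\subseteq 2^U$ is realizable in $\mathbb{R}^d$ if there are oriented affine hyperplanes $(H_e)_{e\in U}$ of $\mathbb{R}^d$, where $H_e=\{x:a_e\cdot x=b_e\}$ with $a_e\neq 0$, $H_e^+=\{x: a_e\cdot x>b_e\}$, $H_e^-=\{x:a_e\cdot x<b_e\}$, and a relatively open convex set $K\subseteq\mathbb{R}^d$ such that a set $X\subseteq U$ belongs to $\mathcal{C}$ if and only if there is $x\in K$ with $x\in H_e^+$ for all $e\in X$ and $x\in H_e^-$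 for all $e\in U\setminus X$.
   Formalization: The convex dimension is taken as the least number d ≥ 1 of generating total orders; with d = 0 allowed, the one-point geometry would have dimension 0 and not be realizable in R^0, as a_e ≠ 0 is impossible there. Only ground sets with at most one element are affected. *)

(* Defs.v *)
From mathcomp Require Import all_boot all_order all_algebra.

Set Implicit Arguments.
Unset Strict Implicit.
Unset Printing Implicit Defensive.

Definition convex_geometry (U : finType) (C : {set {set U}}) : Prop :=
  [/\ set0 \in C /\ [set: U] \in C,
      forall X Y, X \in C -> Y \in C -> X :&: Y \in C
    & forall X, X \in C -> X != [set: U] ->
        exists2 e, e \notin X & e |: X \in C].

Definition total_order (T : Type) (r : rel T) : Prop :=
  [/\ reflexive r, antisymmetric r, transitive r & total r].

(* A list of d total orders, repetitions allowed: dropping repetitions does not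
   change the generated family, so the least d is also the least cardinality of
   a generating set of orders.
   At least one order is required.  With d = 0 the condition on nonempty X would
   read X = U, so that a one-point U would have convex dimension 0, although
   R^0 contains no hyperplane; as soon as U has two points, no convex geometry
   satisfies the condition with d = 0. *)
Definition generates (U : finType) (d : nat) (le : 'I_d -> rel U)
    (C : {set {set U}}) : Prop :=
  [/\ 0 < d,
      forall i, total_order (le i),
      set0 \in C
    & forall X : {set U}, X != set0 ->
        (X \in C <->
         exists e : 'I_d -> U, X = [set x | [forall i, le i (e i) x]])].

Definition convex_dimension (U : finType) (C : {set {set U}}) (d : nat) : Prop :=
  (exists le : 'I_d -> rel U, generates le C) /\
  (forall (d' : nat) (le : 'I_d' -> rel U), generates le C -> d <= d').

(* Required only here: above, set0 and [set _ | _] denote finite sets. *)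
From mathcomp Require Import all_classical all_reals all_analysis.
Import Order.TTheory GRing.Theory Num.Theory.
Import numFieldNormedType.Exports.

Local Open Scope classical_set_scope.
Local Open Scope ring_scope.

Definition dotp (R : realType) (d : nat) (u v : 'rV[R]_d) : R :=
  \sum_(i < d) u 0 i * v 0 i.

Definition pos_halfspace (R : realType) (d : nat) (a : 'rV[R]_d) (b : R) :
    set 'rV[R]_d := [set x | b < dotp a x].

Definition neg_halfspace (R : realType) (d : nat) (a : 'rV[R]_d) (b : R) :
    set 'rV[R]_d := [set x | dotp a x < b].

Definition affine_hull (R : realType) (d : nat) (K : set 'rV[R]_d) :
    set 'rV[R]_d :=
  [set x | exists (n : nat) (c : 'I_n -> R) (p : 'I_n -> 'rV[R]_d),
     [/\ forall j, K (p j), \sum_(j < n) c j = 1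
       & x = \sum_(j < n) c j *: p j]].

Definition relatively_open (R : realType) (d : nat) (K : set 'rV[R]_d) : Prop :=
  open (K : set (subspace (affine_hull K))).

Definition realizable (R : realType) (d : nat) (U : finType)
    (C : {set {set U}}) : Prop :=
  exists (a : U -> 'rV[R]_d) (b : U -> R) (K : set 'rV[R]_d),
    [/\ forall e, a e != 0,
        convex_set (K : set (convex_lmodType 'rV[R]_d)),
        relatively_open K
      & forall X : {set U}, X \in C <->
          exists x, [/\ K x,
            forall e, e \in X -> pos_halfspace (a e) (b e) x
          & forall e, e \notin X -> neg_halfspace (a e) (b e) x]].

Arguments realizable : clear implicits.
Arguments realizable R d {U} C.

(* Main.v *)
Require Import Defs.
From mathcomp Require Import all_boot all_order all_algebra.
From mathcomp Require Import all_classical all_reals all_analysis.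
Import Order.TTheory GRing.Theory Num.Theory.
Import numFieldNormedType.Exports.

(** Let B > d + 1 and let r_i(e) be the position of e in the i-th order.  Take
    for K the open positive orthant and for H_e the hyperplane
    sum_i y_i B^(-r_i(e)) = 1, whose positive side is where the sum is < 1.
    For B large this sum behaves like its largest term, so that with
    y_i ~ B^(t_i) the positive side of H_e is the set where t_i lies below e
    in each of the d orders. *)

Local Open Scope ring_scope.

Definition rank {U : finType} (r : rel U) (e : U) : nat :=
  #|[pred x | r x e & ~~ r e x]|.

(** By transitivity the strict predecessors of [x] are among those of [y], and [x] itself is one of
    [y] but not of [x]. *)
Lemma ltn_rank {U : finType} (r : rel U) (x y : U) :
  total_order r -> ~~ r y x -> (rank r x < rank r y)%N.
Proof.
move=> ord nyx; have [refl _ tr tot] := ord.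
have xy : r x y by have /orP[//|yx] := tot x y; rewrite yx in nyx.
apply/proper_card/fintype.properP; split.
  apply/fintype.subsetP => z; rewrite !inE => /andP[zx nxz]; rewrite (tr _ _ _ zx xy) /=.
  by apply: contraNN nxz => yz; apply: tr xy yz.
by exists x; rewrite !inE ?xy ?nyx // refl.
Qed.

Lemma leq_rank {U : finType} (r : rel U) (x y : U) :
  total_order r -> r x y -> (rank r x <= rank r y)%N.
Proof.
move=> ord xy; have [yx|] := boolP (r y x); last by move/(ltn_rank _ _ _ ord)/ltnW.
by have [_ anti _ _] := ord; rewrite (anti x y) // xy.
Qed.

Lemma open_orthant (R : realType) (d : nat) :
  open [set x : 'rV[R]_d | forall i, 0 < x 0 i]%classic.
Proof.
rewrite openE => x xpos.
apply: (filter_forall (nbhs_filter x)) => i.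
exact: (coord_continuous (lt_nbhsr (xpos i))).
Qed.

Lemma convex_orthant (R : realType) (d : nat) :
  convex_set ([set x : 'rV[R]_d | forall i, 0 < x 0 i]%classic
    : set (convex_lmodType 'rV[R]_d)).
Proof.
apply/convex_setW => x y; rewrite !inE /= => xpos ypos l l_gt0 l_lt1.
rewrite inE /= => i; rewrite !mxE addr_gt0 // mulr_gt0 //.
by rewrite subr_gt0.
Qed.

Section WeightedSum.
Context (R : realType) {U : finType} {d : nat} (le : 'I_d -> rel U).
Hypothesis le_order : forall i, total_order (le i).

(** The least integer above d + 1: [exists_threshold] relies on d + 1 < B, while
    [separated_by_order] gets by with d <= B. *)
Let B : R := d.+2%:R.

Definition weight (e : U) : 'rV[R]_d := \row_i B ^- rank (le i) e.

Let B_ge1 : 1 <= B. Proof. by rewrite ler1n. Qed.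
Let B_gt0 : 0 < B. Proof. by rewrite ltr0n. Qed.

Lemma dotp_weight (e : U) (y : 'rV[R]_d) :
  dotp (weight e) y = \sum_i y 0 i / B ^+ rank (le i) e.
Proof. by apply: eq_bigr => i _; rewrite mxE mulrC. Qed.

(** Together with [dotp_weight_le], this pins the sum between its largest term and d times that
    term. *)
Lemma term_le_dotp_weight (e : U) (y : 'rV[R]_d) (i : 'I_d) :
  (forall j, 0 < y 0 j) -> y 0 i / B ^+ rank (le i) e <= dotp (weight e) y.
Proof.
move=> ypos; rewrite dotp_weight (bigD1 i) //= lerDl sumr_ge0 // => j _.
by rewrite divr_ge0 ?exprn_ge0 // ltW.
Qed.

Lemma dotp_weight_le (e : U) (y : 'rV[R]_d) (c : R) :
  (forall i, y 0 i / B ^+ rank (le i) e <= c) ->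
  dotp (weight e) y <= d%:R * c.
Proof.
move=> yc; rewrite dotp_weight.
apply: le_trans (ler_sum _ (fun i _ => yc i)) _.
by rewrite sumr_const card_ord mulr_natl.
Qed.

(* If e were separated from X in none of the orders, each term of its sum would
   be at most 1/B, by comparison with the term of an element of X below e. *)
Lemma separated_by_order (X : {set U}) (y : 'rV[R]_d) (e : U) :
  (forall i, 0 < y 0 i) ->
  (forall x, x \in X -> dotp (weight x) y < 1) ->
  1 < dotp (weight e) y ->
  exists i, forall x, x \in X -> ~~ le i x e.
Proof.
move=> ypos Xlt egt.
have [/existsP[i /forall_inP iP]|] :=
  boolP [exists i, [forall x in X, ~~ le i x e]]; first by exists i.
rewrite negb_exists => /forallP nsep; exfalso.
have nlt1 x : 1 < dotp (weight x) y -> x \notin X.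
  by move=> xgt; apply/negP => /Xlt; rewrite ltNge (ltW xgt).
have : dotp (weight e) y <= d%:R * B^-1.
  apply: dotp_weight_le => i.
  have := nsep i; rewrite negb_forall => /existsP[x].
  rewrite negb_imply negbK => /andP[xX xe].
  (* The comparison is strict because [x] lies in [X] and [e], whose sum exceeds 1, does not; the
     gap of at least one rank yields the factor 1/B. *)
  have xlt : (rank (le i) x < rank (le i) e)%N.
    apply: ltn_rank => //; apply/negP => ex.
    have [_ anti _ _] := le_order i.
    by move: (nlt1 e egt); rewrite -(anti x e) ?xX // xe.
  have tx := le_lt_trans (term_le_dotp_weight x y i ypos) (Xlt x xX).
  rewrite ler_pdivrMr ?exprn_gt0 // ler_pdivlMl //.
  rewrite ltr_pdivrMr ?exprn_gt0 // mul1r in tx.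
  apply: le_trans (ler_wpM2l (ltW B_gt0) (ltW tx)) _.
  by rewrite -exprS ler_weXn2l.
rewrite leNgt => /negP; apply; apply: le_lt_trans egt.
by rewrite ler_pdivrMr // mul1r ler_nat !leqW.
Qed.

Lemma exists_threshold (t : 'I_d -> U) :
  exists y : 'rV[R]_d, [/\ forall i, 0 < y 0 i,
    forall e, (forall i, le i (t i) e) -> dotp (weight e) y < 1
  & forall e i, ~~ le i (t i) e -> 1 < dotp (weight e) y].
Proof.
(* The i-th term for [e] is B^(r_i(t_i) - r_i(e)) / (d + 1). If [e] is above every t_i, the d terms
   add up to at most d / (d + 1) < 1; if [e] is strictly below some t_i, that single term is at
   least B / (d + 1) > 1. *)
pose y : 'rV[R]_d := \row_i (B ^+ rank (le i) (t i) / d.+1%:R).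
have ypos i : 0 < y 0 i by rewrite mxE divr_gt0 ?exprn_gt0 ?ltr0n.
exists y; split=> // [e te|e i nte].
  apply: (@le_lt_trans _ _ (d%:R * d.+1%:R^-1)).
    apply: dotp_weight_le => i.
    rewrite mxE ler_pdivrMr ?exprn_gt0 // [leRHS]mulrC ler_wpM2r ?invr_ge0 //.
    by rewrite ler_weXn2l // leq_rank.
  by rewrite ltr_pdivrMr ?ltr0n // mul1r ltr_nat.
apply: lt_le_trans (term_le_dotp_weight e y i ypos).
rewrite mxE ltr_pdivlMr ?exprn_gt0 // mul1r ltr_pdivlMr ?ltr0n //.
have lt_r := ltn_rank _ _ _ (le_order i) nte.
apply: (@lt_le_trans _ _ (B ^+ (rank (le i) e).+1)).
  by rewrite exprSr ltr_pM2l ?exprn_gt0 // ltr_nat.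
by rewrite ler_weXn2l.
Qed.

(** Provides the point of the orthant that represents the empty set, which is not of the form
    covered by [exists_threshold]. *)
Lemma exists_above :
  (0 < d)%N ->
  exists y : 'rV[R]_d,
    (forall i, 0 < y 0 i) /\ forall e, 1 < dotp (weight e) y.
Proof.
(* Ranks are at most #|U|, so with this exponent one term, available since 0 < d, already exceeds
   1. *)
move=> d_gt0; exists (const_mx (B ^+ #|U|.+1)).
have ypos i : 0 < (const_mx (B ^+ #|U|.+1) : 'rV[R]_d) 0 i.
  by rewrite mxE exprn_gt0.
split=> // e; apply: lt_le_trans (term_le_dotp_weight e _ (Ordinal d_gt0) ypos).
rewrite mxE ltr_pdivlMr ?exprn_gt0 // mul1r ltr_eXn2l ?ltr1n //.
by rewrite ltnS max_card.
Qed.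

End WeightedSum.

Theorem theorem35 (R : realType) (U : finType) (C : {set {set U}}) (d : nat)
    (hC : convex_geometry C) (hd : convex_dimension C d) :
  realizable R d C.
Proof.
have [[le [d_gt0 le_order C0 CP]] _] := hd.
(* Both signs are flipped so that the positive side is where the weighted sum is below 1. *)
exists (fun e => - weight R le e), (fun=> -1).
exists [set x | forall i, 0 < x 0 i]%classic.
have dotpN (u v : 'rV[R]_d) : dotp (- u) v = - dotp u v.
  by rewrite /dotp -sumrN; apply: eq_bigr => i _; rewrite mxE mulNr.
split.
- move=> e; rewrite oppr_eq0; apply/eqP => /rowP/(_ (Ordinal d_gt0)).
  by rewrite !mxE => /eqP; rewrite invr_eq0 expf_eq0 pnatr_eq0 andbF.
- exact: convex_orthant.
- exact: open_subspaceW (open_orthant R d).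
move=> X; rewrite /pos_halfspace /neg_halfspace /=; split=> [XC|[y [ypos Xpos Xneg]]].
  have [X0|X_neq0] := eqVneq X finset.set0.
    have [y [ypos yP]] := exists_above R le d_gt0.
    exists y; split=> // e; first by rewrite X0 inE.
    by rewrite dotpN ltrN2.
  have [t XE] := (CP X X_neq0).1 XC.
  have [y [ypos ylt ygt]] := exists_threshold R le le_order t.
  exists y; split=> // e; rewrite XE inE dotpN ltrN2 => /forallP.
    exact: ylt.
  by move/forallP; rewrite negb_forall => /existsP[i /ygt].
have [->//|X_neq0] := eqVneq X finset.set0.
have {}Xpos x : x \in X -> dotp (weight R le x) y < 1.
  by move=> /Xpos; rewrite dotpN ltrN2.
have {}Xneg e : e \notin X -> 1 < dotp (weight R le e) y.
  by move=> /Xneg; rewrite dotpN ltrN2.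
have /finset.set0Pn[x0 x0X] := X_neq0.
apply/(CP X X_neq0).
(* The thresholds of [X] are its least elements in the d orders. *)
pose t i := [arg min_(x < x0 in X) rank (le i) x]%N.
have tP i : t i \in X /\ forall x, x \in X -> le i (t i) x.
  rewrite /t; case: arg_minnP => // m mX mmin; split=> // x xX.
  have := mmin x xX; rewrite leqNgt; apply: contraNT.
  exact: ltn_rank.
exists t; apply/finset.setP => e; rewrite inE.
apply/idP/forallP => [eX i|te]; first exact: (tP i).2.
(* An [e] outside [X] would lie strictly below all of [X] in some order i, yet it is above t_i,
   which belongs to [X]. *)
apply/negPn/negP => /Xneg egt.
have [i iP] := separated_by_order R le le_order X y e ypos Xpos egt.
by have := iP _ (tP i).1; rewrite te.
Qed.
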